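(* Let $n\ge3$, and let $M$ be an $n$-compartment Fin model $(\mathrm{Fin}_n,In,Out,Leak)$ or Wing model $(\mathrm{Wing}_n,In,Out,Leak)$, with $In=Out=\{1\}$ and at most one leak ($|Leak|\le1$). Then $M$ is generically locally identifiable.
   Context: A linear compartmental model $(G,In,Out,Leak)$ consists of a directed graph $G=(V,E)$ with $V=\{1,\dots,n\}$ (vertices are called compartments) and subsets $In,Out,Leak\subseteq V$. Each edge $j\to i$ has a parameter $k_{ij}$, and each $j\in Leak$ has a parameter $k_{0j}$. The compartmental matrix $A$ is the $n\times n$ matrix with off-diagonal entries $A_{ij}=k_{ij}$ if $j\to i\in E$ and $0$ otherwise, and diagonal entries $A_{ii}=-\sum_{p:\,i\to p\in E}k_{pi}$ if $i\notin Leak$, $A_{ii}=-k_{0i}-\sum_{p:\,i\to p\in E}k_{pi}$ if $i\in Leak$. Let $\partial I$ be the $n\times n$ diagonal matrix with all diagonal entries the differential operator $d/dt$, and let $(B)_{ji}$ denote $B$ with row $j$ and column $i$ removed. The input-output equations are, for $i\in Out$, $$\det(\partial I-A)\,y_i=\sum_{j\in In}(-1)^{i+j}\det\big((\partial I-A)_{ji}\big)\,u_j ,$$ with both sides expanded in powers of $d/dt$ (i.e., in derivatives of the $y_i$ and $u_j$). The coefficient map $c:\mathbb{R}^{|E|+|Leak|}\to\mathbb{R}^m$ sends the vector of parameters to the vector of all non-monic coefficients of these equations (coefficients identically equal to $1$ are omitted, as are coefficients identically $0$). A strongly connected model with at least one input is generically locally identifiable if, outside a set of measure zero, every point of $\mathbb{R}^{|E|+|Leak|}$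 has an open neighborhood $U$ such that $c|_U$ is one-to-one. The $n$-compartment cycle graph has edges $1\to2\to3\to\cdots\to n\to1$. The graph $\mathrm{Fin}_n$ is obtained from it by adding all incoming edges $i\to1$, $i\in\{2,3,\dots,n-1\}$ (parameters $k_{12},k_{13},\dots,k_{1,n-1}$). The graph $\mathrm{Wing}_n$ is obtained from it by adding all outgoing edges $1\to j$, $j\in\{3,4,\dots,n\}$ (parameters $k_{31},k_{41},\dots,k_{n1}$). *)

(* Defs.v *)
From mathcomp Require Export all_boot all_order all_algebra.
From mathcomp Require Export all_classical all_reals all_analysis.
Export GRing.Theory Num.Theory numFieldNormedType.Exports.

Set Implicit Arguments.
Unset Strict Implicit.
Unset Printing Implicit Defensive.

Local Open Scope classical_set_scope.
Local Open Scope ring_scope.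

(** Compartments [1, ..., n] are the elements of ['I_n]; the compartment
    called [v] in the mathematical text is the ordinal of value [v - 1]. *)
Definition label n (i : 'I_n) : nat := i.+1.

Record model (n : nat) := Model {
  edge : rel 'I_n;  (* [edge i j] is the edge i -> j *)
  In : {set 'I_n};
  Out : {set 'I_n};
  Leak : {set 'I_n} }.

Definition strongly_connected n (M : model n) : Prop :=
  forall i j, connect (edge M) i j.

(** One parameter per edge [j -> i] (the pair [(j, i)]) and one per leak. *)
Definition param n (M : model n) : finType :=
  ({e : 'I_n * 'I_n | edge M e.1 e.2} + {j : 'I_n | j \in Leak M})%type.

Section CoefficientMap.
Variables (R : realType) (n : nat) (M : model n).

Notation parameters := 'rV[R]_#|param M|.

(** [edge_rate theta i j] is k_ij, attached to j -> i; [leak_rate theta j] is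
    k_0j.  Both are 0 when the edge, resp. the leak, is not in the model. *)
Definition edge_rate (theta : parameters) (i j : 'I_n) : R :=
  if insub (j, i) is Some e then theta 0 (enum_rank (inl e : param M)) else 0.

Definition leak_rate (theta : parameters) (j : 'I_n) : R :=
  if insub j is Some l then theta 0 (enum_rank (inr l : param M)) else 0.

Definition compartmental_matrix (theta : parameters) : 'M[R]_n :=
  \matrix_(i, j)
    if i == j then - leak_rate theta i - \sum_(p | edge M i p) edge_rate theta p i
    else edge_rate theta i j.

(** [inl (i, k)] stands for the coefficient of the k-th derivative of y_i on the
    left-hand side of the equation of output i; [inr (i, j, k)] for that of the
    k-th derivative of u_j on its right-hand side. *)
Definition coef_index : finType :=
  ('I_n * 'I_n.+1 + 'I_n * 'I_n * 'I_n)%type.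

Definition occurs (x : coef_index) : bool :=
  match x with
  | inl (i, _) => i \in Out M
  | inr (i, j, _) => (i \in Out M) && (j \in In M)
  end.

(** The indeterminate ['X] plays the role of d/dt, so that [char_poly_mx A] is
    the matrix (d/dt) I - A.  The sign (-1)^(i+j) is part of [cofactor], and is
    not affected by the shift between labels and ordinals. *)
Definition io_coef (theta : parameters) (x : coef_index) : R :=
  let A := compartmental_matrix theta in
  match x with
  | inl (_, k) => (char_poly A)`_k
  | inr (i, j, k) => (cofactor (char_poly_mx A) j i)`_k
  end.

Definition identically (x : coef_index) (a : R) : Prop :=
  forall theta, io_coef theta x = a.

Definition kept_coefs : {set coef_index} :=
  [set x | [&& occurs x, ~~ `[< identically x 0 >] & ~~ `[< identically x 1 >]]]%SET.

Definition coef_map (theta : parameters) : 'rV[R]_#|kept_coefs| :=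
  \row_s io_coef theta (enum_val s).

End CoefficientMap.

Section NullSets.
Variables (R : realType) (N : nat).

Definition box (a b : 'rV[R]_N) : set 'rV[R]_N :=
  [set x | forall i, a 0 i <= x 0 i <= b 0 i].

Definition box_volume (a b : 'rV[R]_N) : R := \prod_(i < N) (b 0 i - a 0 i).

(** Sets of N-dimensional Lebesgue (outer) measure zero.  Covers may be indexed
    by any subset of [nat], so that [set0] is null even when N = 0, where every
    box has volume 1. *)
Definition measure_zero (Z : set 'rV[R]_N) : Prop :=
  forall eps : R, 0 < eps ->
  exists (D : set nat) (a b : nat -> 'rV[R]_N),
    [/\ forall k i, a k 0 i <= b k 0 i,
        Z `<=` \bigcup_(k in D) box (a k) (b k) &
        (\esum_(k in D) (box_volume (a k) (b k))%:E <= eps%:E)%E].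

End NullSets.

(** The notion is only meaningful for strongly connected models with at least
    one input; these requirements are made part of it. *)
Definition generically_locally_identifiable (R : realType) n (M : model n) : Prop :=
  [/\ strongly_connected M, In M != finset.set0 &
      exists Z : set 'rV[R]_#|param M|, measure_zero Z /\
        forall theta, ~ Z theta ->
          exists U : set 'rV[R]_#|param M|,
            [/\ open U, U theta & {in U &, injective (@coef_map R n M)}]].

Definition cycle_graph n : rel 'I_n := fun i j =>
  (label j == (label i).+1) || ((label i == n) && (label j == 1%N)).

Definition fin_graph n : rel 'I_n := fun i j =>
  cycle_graph i j || ((2 <= label i <= n.-1)%N && (label j == 1%N)).

Definition wing_graph n : rel 'I_n := fun i j =>
  cycle_graph i j || ((label i == 1%N) && (3 <= label j <= n)%N).

(* Main.v *)
Require Import Defs.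
From mathcomp Require Import ring.
Import Order.TTheory.

(** In both families every cycle of the graph goes through compartment 1.  So,
    once its row and column are removed, (d/dt) I - A is triangular, and the
    right-hand side of the input-output equation is the product of the
    X + s_i, i <> 1, where s_i = - A i i is the total outflow of compartment i.
    Generically these outflows are distinct and nearby parameters with the same
    right-hand side have the same s_i (identifiable_of_recovery).

    The left-hand side is (X + s_1) T_1 - sum_j e_j T_j, where the polynomials
    T_j are products of some of the X + s_i, hence known, and have distinct
    degrees, so that s_1 and the e_j are determined too (bordered_det_inj).  Each
    e_j is the product of the rates along a cycle: there is one such cycle for
    each way back to, or out of, compartment 1 (fin_char_poly, wing_char_poly).

    It remains to solve for the rates, which explicit rational formulas do
    wherever a few linear forms do not vanish (fin_recover, wing_recover); without
    leak, conservation of mass imposes one relation on the data, and it is this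
    redundancy that leaves room for one leak rate.

    The exceptional parameters thus lie in finitely many hyperplanes, which are
    null (measure_zero_hyperplane).

    Below, compartments are numbered from 0 to m, as ordinals are. *)

Set Implicit Arguments.
Unset Strict Implicit.
Unset Printing Implicit Defensive.

Local Open Scope classical_set_scope.
Local Open Scope ring_scope.

(** * Null sets and linear functionals *)

Section NullSets.
Variables (R : realType) (N : nat).
Implicit Types (Z : set 'rV[R]_N) (a b : 'rV[R]_N).

Lemma box_volume_ge0 a b : (forall i, a 0 i <= b 0 i) -> 0 <= box_volume a b.
Proof. by move=> ab; apply: prodr_ge0 => i _; rewrite subr_ge0. Qed.

Lemma measure_zeroS Z Z' : Z `<=` Z' -> measure_zero Z' -> measure_zero Z.
Proof.
move=> ZZ' Z'0 eps /Z'0[D [a [b [ab cov vol]]]].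
by exists D, a, b; split=> //; apply: subset_trans cov.
Qed.

Definition has_cover Z (eps : R) : Prop :=
  exists (D : set nat) (a b : nat -> 'rV[R]_N),
    [/\ forall k i, a k 0 i <= b k 0 i,
        Z `<=` \bigcup_(k in D) box (a k) (b k) &
        (\esum_(k in D) (box_volume (a k) (b k))%:E <= eps%:E)%E].

(** The index set of a cover is immaterial as long as it is countable: this
    frees the covers below from explicit numberings. *)
Lemma countable_cover (I : countType) (D : set I) (a b : I -> 'rV[R]_N) Z
    (eps : R) :
  (forall k i, D k -> a k 0 i <= b k 0 i) ->
  Z `<=` \bigcup_(k in D) box (a k) (b k) ->
  (\esum_(k in D) (box_volume (a k) (b k))%:E <= eps%:E)%E ->
  has_cover Z eps.
Proof.
move=> ab cov vol.
pose ext (x : I -> 'rV[R]_N) n :=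
  if unpickle n is Some k then (if `[< D k >] then x k else 0) else 0.
exists (pickle @` D), (ext a), (ext b).
have extE x k : D k -> ext x (pickle k) = x k.
  by move=> Dk; rewrite /ext pickleK asboolT.
split=> [n i | z /cov[k Dk zk] | ].
- rewrite /ext; case: unpickle => // k; case: asboolP => // Dk; exact: ab.
- by exists (pickle k) => /=; [exists k | rewrite !extE].
- have bij : set_bij D (pickle @` D) (@pickle I).
    by split=> // k k' _ _; apply: (pcan_inj (@pickleK I)).
  rewrite (reindex_esum _ _ _ _ bij); apply: le_trans vol.
  by apply: le_esum => k Dk; rewrite !extE.
Qed.

(** The classical argument: the t-th set is covered up to eps / 2 ^ (t + 1). *)
Lemma measure_zero_bigcup (T : countType) (Z : T -> set 'rV[R]_N) :
  (forall t, measure_zero (Z t)) -> measure_zero (\bigcup_t Z t).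
Proof.
move=> Z0 eps eps0.
pose e (t : T) : R := eps / (2 ^ (pickle t).+1)%:R.
have e0 t : 0 < e t by rewrite divr_gt0// ltr0n expn_gt0.
have /choice[c cP] t : exists c : set nat * ((nat -> 'rV[R]_N) * (nat -> 'rV[R]_N)),
    [/\ forall k i, c.2.1 k 0 i <= c.2.2 k 0 i,
        Z t `<=` \bigcup_(k in c.1) box (c.2.1 k) (c.2.2 k) &
        (\esum_(k in c.1) (box_volume (c.2.1 k) (c.2.2 k))%:E <= (e t)%:E)%E].
  by have [D [a [b ?]]] := Z0 t _ (e0 t); exists (D, (a, b)).
apply: (@countable_cover _ ([set: T] `*`` fun t => (c t).1)
  (fun k => (c k.1).2.1 k.2) (fun k => (c k.1).2.2 k.2)).
- by move=> [t k] i /= _; have [+ _ _] := cP t.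
- move=> z [t _ Zz]; have [_ cov _] := cP t.
  by have [k Dk zk] := cov _ Zz; exists (t, k).
rewrite -(esum_esum (a := fun t k => (box_volume ((c t).2.1 k) ((c t).2.2 k))%:E)).
  have sum_e : (\esum_(t in [set: T]) (e t)%:E <= eps%:E)%E.
    have tE : (\esum_(n in pickle @` [set: T]) (eps / (2 ^ n.+1)%:R)%:E =
        \esum_(t in [set: T]) (e t)%:E)%E.
      have bij : set_bij [set: T] (pickle @` [set: T]) (@pickle T).
        by split=> // k k' _ _; apply: (pcan_inj (@pickleK T)).
      exact: reindex_esum.
    rewrite -tE; apply: le_trans (epsilon_trick0 xpredT (ltW eps0)).
    rewrite nneseries_esumT; last first.
      by move=> n; rewrite lee_fin divr_ge0// ltW.
    rewrite esum_mkcond; apply: le_esum => n _; case: ifP => // _.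
    by rewrite lee_fin divr_ge0// ltW.
  apply: le_trans sum_e; apply: le_esum => t _; by have [_ _] := cP t.
move=> t k _ _; rewrite lee_fin; apply: box_volume_ge0 => i; by have [+ _ _] := cP t.
Qed.

Lemma finite_cover (F : finType) (a b : F -> 'rV[R]_N) Z (eps : R) :
  (forall k i, a k 0 i <= b k 0 i) ->
  Z `<=` \bigcup_k box (a k) (b k) ->
  \sum_k box_volume (a k) (b k) <= eps ->
  has_cover Z eps.
Proof.
move=> ab cov vol; apply: (countable_cover _ cov) => [k i _|]; first exact: ab.
rewrite (esum_fset finite_finset); last by move=> k _; rewrite lee_fin box_volume_ge0.
have -> : [set: F] = [set` index_enum F].
  by apply/seteqP; split=> k //= _; rewrite mem_index_enum.
by rewrite -fsbig_seq ?index_enum_uniq// sumEFin lee_fin.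
Qed.

Lemma unit_cell (K : nat) (y : R) : (0 < K)%N -> 0 <= y <= K%:R ->
  exists k : 'I_K, (k%:R <= y <= k%:R + 1).
Proof.
elim: K => // -[_ _ /andP[y0 y1]|K IH _ /andP[y0 yK]].
  by exists ord0; rewrite /= y0 add0r.
have [yK'|/ltW yK'] := leP y K.+1%:R; last first.
  by exists ord_max; rewrite /= yK' natr1.
by have [|k kP] := IH erefl; [rewrite y0 | exists (widen_ord (leqnSn _) k)].
Qed.

Section Hyperplane.
Variable f : 'rV[R]_N -> R.
Hypothesis f_lin : scalar f.

Lemma functional0 : f 0 = 0.
Proof. by have := f_lin (-1) 0 0; rewrite scaler0 addr0 mulN1r addNr. Qed.

Lemma functionalE x : f x = \sum_j x 0 j * f (delta_mx 0 j).
Proof.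
rewrite {1}[x]row_sum_delta.
apply: (big_ind2 (fun y s => f y = s)) => [|u a v b <- <-|j _].
- exact: functional0.
- by have := f_lin 1 u v; rewrite scale1r mul1r.
- by rewrite -[_ *: _]addr0 f_lin functional0 addr0.
Qed.

(** On the kernel of f some coordinate i is a Lipschitz function g of the
    others.  So the part of the kernel in a cube of side 2b is covered, for every
    K, by one box over each of the (K + 1)^(N - 1) cells of a grid of mesh
    h = 2b / (K + 1) on the other coordinates, of height proportional to h; the
    total volume is O(1 / K). *)
Lemma measure_zero_hyperplane w : f w != 0 -> measure_zero [set x | f x = 0].
Proof.
move=> fw.
have [i ci0] : exists i, f (delta_mx 0 i) != 0.
  apply/existsP; apply: contraNT fw => /existsPn f0; rewrite functionalE.
  by apply/eqP/big1 => j _; have := f0 j; rewrite negbK => /eqP ->; rewrite mulr0.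
pose q j := - (f (delta_mx 0 j) / f (delta_mx 0 i)).
pose g (x : 'rV[R]_N) := \sum_(j | j != i) q j * x 0 j.
pose C := \sum_(j | j != i) `|q j|.
have fg x : f x = 0 -> x 0 i = g x.
  rewrite functionalE (bigD1 i)//= => /eqP; rewrite addr_eq0 => /eqP E.
  apply: (mulIf ci0); rewrite E /g mulr_suml -sumrN; apply: eq_bigr => j _.
  by rewrite /q !mulNr mulrAC divfK// mulrC.
have C0 : 0 <= C by apply: sumr_ge0.
pose Z (B : nat) := [set x : 'rV[R]_N | f x = 0 /\ forall j, `|x 0 j| <= B.+1%:R].
suff Z0 B : measure_zero (Z B).
  apply: measure_zeroS (measure_zero_bigcup Z0) => x /= fx0.
  have [B HB] : exists B, forall j, `|x 0 j| <= (B.+1)%:R.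
    exists (\max_(j < N) Num.trunc (`|x 0 j|)%R)%N => j.
    apply: ltW; apply: lt_le_trans (truncnS_gt _) _.
    by rewrite ler_nat ltnS (leq_bigmax j).
  by exists B => //; split.
move=> eps eps0; pose b : R := B.+1%:R.
have b0 : 0 < b by rewrite ltr0n.
pose vol K : R := \prod_(j < N | j != i) (b *+ 2) * (C * (b *+ 2 / K.+1%:R) *+ 2).
have [K volK] : exists K, vol K <= eps.
  pose T := (\prod_(j < N | j != i) (b *+ 2)) * (C * (b *+ 2) *+ 2).
  exists (Num.trunc (T / eps)).
  have -> K : vol K = T / K.+1%:R.
    by rewrite -[RHS]mulrA; congr (_ * _); rewrite [RHS]mulrnAl -mulrA.
  rewrite ler_pdivrMr ?ltr0n// -ler_pdivrMl// mulrC ltW//.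
  exact: truncnS_gt.
pose h : R := b *+ 2 / K.+1%:R.
have h0 : 0 < h by rewrite divr_gt0 ?mulrn_wgt0.
(* A cell of the grid is a function t; only those with t i = 0 matter, and the
   boxes of the others are made flat, so that the total volume is a product of
   sums over the coordinates. *)
pose xi (t : {ffun 'I_N -> 'I_K.+1}) : 'rV[R]_N := \row_j (- b + h * (t j)%:R).
pose lo (t : {ffun 'I_N -> 'I_K.+1}) : 'rV[R]_N := \row_j
  if j != i then xi t 0 j else if t i == ord0 then g (xi t) - C * h else 0.
pose hi (t : {ffun 'I_N -> 'I_K.+1}) : 'rV[R]_N := \row_j
  if j != i then xi t 0 j + h else if t i == ord0 then g (xi t) + C * h else 0.
apply: (@finite_cover _ lo hi).
- move=> t j; rewrite !mxE; case: ifP => _; first by rewrite lerDl ltW.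
  case: ifP => // _; rewrite lerD2l; apply: (@le_trans _ _ 0).
    by rewrite oppr_le0 mulr_ge0// ltW.
  by rewrite mulr_ge0// ltW.
- move=> x [fx0 xB].
  have /choice[t tP] j : exists k : 'I_K.+1,
      - b + h * k%:R <= x 0 j <= - b + h * k%:R + h.
    have [//||k /andP[k1 k2]] := @unit_cell K.+1 ((x 0 j + b) / h).
      have := xB j; rewrite ler_norml -/b => /andP[x1 x2].
      rewrite divr_ge0 ?(ltW h0)//=; last by rewrite -lerBlDr sub0r.
      by rewrite ler_pdivrMr// /h mulrCA mulfV ?pnatr_eq0// mulr1 mulr2n lerD2r.
    exists k; move: k1 k2; rewrite ler_pdivlMr// ler_pdivrMr// mulrDl mul1r.
    rewrite [_ * h]mulrC => k1 k2; apply/andP; split.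
      by rewrite addrC lerBlDr.
    by rewrite -addrA [- b + _]addrC lerBrDr.
  pose t' : {ffun 'I_N -> 'I_K.+1} := [ffun j => if j == i then ord0 else t j].
  exists t' => // j; rewrite !mxE.
  have [->|ji] := eqVneq j i; last by rewrite ffunE (negPf ji); exact: tP.
  rewrite ffunE eqxx /=.
  have : `|x 0 i - g (xi t')| <= C * h.
    rewrite fg// -sumrB /C mulr_suml; apply: le_trans (ler_norm_sum _ _ _) _.
    apply: ler_sum => k ki; rewrite -mulrBr normrM ler_wpM2l//.
    have /andP[t1 t2] := tP k; rewrite !mxE ffunE (negPf ki).
    by rewrite ger0_norm ?subr_ge0// lerBlDl.
  by rewrite ler_norml lerBrDr lerBlDl addrC.
pose v j (k : 'I_K.+1) : R :=
  if j != i then h else if k == ord0 then C * h *+ 2 else 0.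
have -> : \sum_t box_volume (lo t) (hi t) = \prod_j \sum_k v j k.
  rewrite bigA_distr_bigA; apply: eq_bigr => t _; apply: eq_bigr => j _.
  rewrite !mxE /v; case: eqVneq => [->|_] /=; last by rewrite addrAC subrr add0r.
  case: ifP => _; last by rewrite subrr.
  by rewrite opprB addrC addrA subrK mulr2n.
suff -> : \prod_j \sum_k v j k = vol K by [].
rewrite (bigD1 i)//= mulrC; congr (_ * _).
  by apply: eq_bigr => j ji; rewrite /v ji sumr_const card_ord -mulr_natr divfK.
rewrite (bigD1 ord0)//= big1 ?addr0 => [|k /negPf k0]; rewrite /v eqxx //=.
by rewrite k0.
Qed.
End Hyperplane.
End NullSets.

Lemma scalar_continuous (R : realType) N (f : 'rV[R]_N -> R) :
  scalar f -> continuous f.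
Proof.
move=> f_lin; have -> : f = fun x => \sum_j x 0 j * f (delta_mx 0 j).
  by apply/funext => x; exact: functionalE.
move=> x; have filt : Filter (nbhs x) by exact: nbhs_filter.
apply: (@cvg_big R^o _ _ _ _ (@add_continuous R^o) _ _ _ _ _ filt) => j _.
by apply: cvgM; [exact: coord_continuous | exact: cvg_cst].
Qed.

(** * Rates as linear functionals of the parameters *)

Section Rates.
Variables (R : realType) (n : nat) (M : model n).
Implicit Types theta : 'rV[R]_#|param M|.

Lemma scalar_edge_rate i j : scalar (fun theta => edge_rate theta i j).
Proof.
move=> t x y; rewrite /edge_rate; case: insub => [e|]; first by rewrite !mxE.
by rewrite mulr0 addr0.
Qed.

Lemma scalar_leak_rate j : scalar (fun theta => leak_rate theta j).
Proof.
move=> t x y; rewrite /leak_rate; case: insub => [e|]; first by rewrite !mxE.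
by rewrite mulr0 addr0.
Qed.

Lemma scalarD (f g : 'rV[R]_#|param M| -> R) :
  scalar f -> scalar g -> scalar (fun x => f x + g x).
Proof. by move=> fl gl t x y; rewrite fl gl mulrDr addrACA. Qed.

Lemma scalarN (f : 'rV[R]_#|param M| -> R) :
  scalar f -> scalar (fun x => - f x).
Proof. by move=> fl t x y; rewrite fl opprD mulrN. Qed.

Lemma scalar_sum (I : finType) (P : pred I) (f : I -> 'rV[R]_#|param M| -> R) :
  (forall i, P i -> scalar (f i)) -> scalar (fun x => \sum_(i | P i) f i x).
Proof.
move=> fl t x y; rewrite mulr_sumr -big_split; apply: eq_bigr => i Pi; exact: fl.
Qed.

Lemma scalar_compartmental_matrix i j :
  scalar (fun theta => compartmental_matrix theta i j).
Proof.
suff -> : (fun theta => compartmental_matrix theta i j) = fun theta =>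
    if i == j then - leak_rate theta i + - \sum_(p | edge M i p) edge_rate theta p i
    else edge_rate theta i j.
  case: eqP => _; last exact: scalar_edge_rate.
  apply: scalarD; apply: scalarN; first exact: scalar_leak_rate.
  by apply: scalar_sum => p _; exact: scalar_edge_rate.
by apply/funext => theta; rewrite mxE.
Qed.

Lemma edge_rate0 theta i j : ~~ edge M j i -> edge_rate theta i j = 0.
Proof. by rewrite /edge_rate; case: insubP => // e /= ->. Qed.

Lemma leak_rate0 theta j : j \notin Leak M -> leak_rate theta j = 0.
Proof. by rewrite /leak_rate; case: insubP => // l /= ->. Qed.

Lemma rates_inj theta theta' :
  (forall i j, edge_rate theta i j = edge_rate theta' i j) ->
  (forall j, leak_rate theta j = leak_rate theta' j) -> theta = theta'.
Proof.
move=> edges leaks; apply/rowP => s; rewrite -(enum_valK s).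
case: (enum_val s) => [[[j i] ij]|[j lj]].
  by have := edges i j; rewrite /edge_rate insubT.
by have := leaks j; rewrite /leak_rate insubT.
Qed.

Lemma exists_rates (k : 'I_n -> 'I_n -> R) (l : 'I_n -> R) :
  exists theta, (forall i j, edge_rate theta i j = if edge M j i then k i j else 0)
             /\ (forall j, leak_rate theta j = if j \in Leak M then l j else 0).
Proof.
exists (\row_s match enum_val s with
               | inl e => k (val e).2 (val e).1 | inr j => l (val j) end).
split=> [i j|j].
  rewrite /edge_rate; case: insubP => [e|]; last by move/negPf=> /= ->.
  by move=> /= -> ee; rewrite mxE enum_rankK ee.
rewrite /leak_rate; case: insubP => [e|]; last by move/negPf=> /= ->.
by move=> -> ee; rewrite mxE enum_rankK ee.
Qed.

End Rates.

(** * Reduction of identifiability to a recovery problem *)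

Lemma prod_XsubC_root (R : idomainType) m (a b : 'I_m -> R) :
  \prod_i ('X - (a i)%:P) = \prod_i ('X - (b i)%:P) ->
  forall i, exists j, a i = b j.
Proof.
move=> eq_prod i; move/(congr1 (horner^~ (a i))): eq_prod.
rewrite !horner_prod (bigD1 i)//= hornerXsubC subrr mul0r => /esym/eqP.
by move=> /prodf_eq0[j _]; rewrite hornerXsubC subr_eq0 => /eqP; exists j.
Qed.

Section Identification.
Variables (R : realType) (m : nat) (M : model m.+1).
Hypotheses (In1 : In M = [set ord0]%SET) (Out1 : Out M = [set ord0]%SET).
Local Notation A := (@compartmental_matrix R _ M).

(** A coefficient left out of the coefficient map is constant, so that the
    coefficient map determines all the coefficients of the equation. *)
Lemma io_coef_eq theta theta' x : @coef_map R _ M theta = coef_map theta' ->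
  occurs M x -> io_coef theta x = io_coef theta' x.
Proof.
move=> /rowP eqc occ; have [kept|] := boolP (x \in @kept_coefs R _ M).
  by have := eqc (enum_rank_in kept x); rewrite !mxE enum_rankK_in.
rewrite !inE occ /= negb_and !negbK => /orP[/asboolP id|/asboolP id];
  by rewrite !id.
Qed.

Definition input_minor (B : 'M[R]_m.+1) : 'M[R]_m := row' ord0 (col' ord0 B).

Lemma cofactor_char_poly (B : 'M[R]_m.+1) :
  cofactor (char_poly_mx B) ord0 ord0 = char_poly (input_minor B).
Proof.
rewrite /cofactor expr0 mul1r /char_poly; congr (\det _).
by apply/matrixP => i j; rewrite !mxE (inj_eq lift_inj).
Qed.

Lemma coef_map_eq theta theta' : coef_map theta = coef_map theta' ->
  char_poly (A theta) = char_poly (A theta') /\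
  char_poly (input_minor (A theta)) = char_poly (input_minor (A theta')).
Proof.
move=> eqc; split; apply/polyP => k.
  have [km|km] := ltnP k m.+2; last by rewrite !nth_default ?size_char_poly.
  have := @io_coef_eq _ _ (inl (ord0, Ordinal km)) eqc.
  by rewrite /= Out1 inE eqxx; apply.
have [km|km] := ltnP k m.+1; last by rewrite !nth_default ?size_char_poly.
have := @io_coef_eq _ _ (inr (ord0, ord0, Ordinal km)) eqc.
by rewrite /= !cofactor_char_poly Out1 In1 inE eqxx; apply.
Qed.

(** Without compartment 0 the graph has no cycle: an edge between two of the
    other compartments increases the label. *)
Definition acyclic_off_input (B : 'M[R]_m.+1) :=
  forall i j : 'I_m.+1, (0 < i)%N -> (i < j)%N -> B i j = 0.

Lemma char_poly_input_minor (B : 'M[R]_m.+1) : acyclic_off_input B ->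
  char_poly (input_minor B) =
  \prod_(i < m) ('X - (B (lift ord0 i) (lift ord0 i))%:P).
Proof.
move=> Btri; rewrite char_poly_trig => [|].
  by apply: eq_bigr => i _; rewrite !mxE.
by apply/is_trig_mxP => i j ij; rewrite !mxE Btri.
Qed.

Hypothesis A_acyclic : forall theta, acyclic_off_input (A theta).
Hypothesis strong : strongly_connected M.

(** The right-hand side of the equation has the roots [A i i], i > 0.  It
    determines them up to their order, and where they are distinct it determines
    them locally with their order, since close values cannot be permuted.  So,
    away from the hyperplanes where two of them coincide, the diagonal entries
    may be treated as known in the recovery of the parameters.  The point [w]
    certifies that each functional whose zeros are discarded is not zero. *)
Lemma identifiable_of_recovery (F : finType)
    (L : F -> 'rV[R]_#|param M| -> R) (w : 'rV[R]_#|param M|) :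
  (forall d, scalar (L d)) -> (forall d, L d w != 0) ->
  (forall i j : 'I_m, i != j ->
     A w (lift ord0 i) (lift ord0 i) != A w (lift ord0 j) (lift ord0 j)) ->
  (forall theta theta', (forall d, L d theta != 0) -> (forall d, L d theta' != 0) ->
     (forall i : 'I_m, A theta (lift ord0 i) (lift ord0 i) =
                       A theta' (lift ord0 i) (lift ord0 i)) ->
     char_poly (A theta) = char_poly (A theta') -> theta = theta') ->
  generically_locally_identifiable R M.
Proof.
move=> L_lin Lw w_gaps recover.
pose s theta (i : 'I_m) : R := A theta (lift ord0 i) (lift ord0 i).
have s_lin i : scalar (s^~ i) by exact: scalar_compartmental_matrix.
pose gap (p : 'I_m * 'I_m) theta := s theta p.1 + - s theta p.2.
have gap_lin p : scalar (gap p) by apply/scalarD => //; exact/scalarN.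
pose bad (c : F + {p : 'I_m * 'I_m | p.1 != p.2}) :=
  match c with inl d => [set theta | L d theta = 0]
             | inr p => [set theta | gap (val p) theta = 0] end.
split=> //; first by rewrite In1; apply/set0Pn; exists ord0; rewrite inE.
exists (\bigcup_c bad c); split.
  apply: measure_zero_bigcup => -[d|[p pneq]] /=.
    exact: measure_zero_hyperplane (L_lin d) _ (Lw d).
  by apply: (measure_zero_hyperplane (gap_lin p) (w := w)); rewrite subr_eq0 w_gaps.
move=> theta0 good.
have L0 d : L d theta0 != 0 by apply/eqP => ?; apply: good; exists (inl d).
have gap0 i j : i != j -> 0 < `|s theta0 i - s theta0 j| / 2.
  move=> ij; rewrite divr_gt0// normr_gt0; apply/eqP => ?.
  by apply: good; exists (inr (exist _ (i, j) ij)).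
have filt : Filter (nbhs theta0) by exact: nbhs_filter.
have nearL : \forall theta \near theta0, forall d, L d theta != 0.
  apply: (@filter_forall _ F (fun d theta => L d theta != 0) _ filt) => d.
  exact: cvgr_neq0 (scalar_continuous (L_lin d) (x:=theta0)) (L0 d).
have near_gap : \forall theta \near theta0, forall p : 'I_m * 'I_m, p.1 != p.2 ->
    `|s theta0 p.1 - s theta p.1| < `|s theta0 p.1 - s theta0 p.2| / 2.
  apply: (@filter_forall _ _ (fun (p : 'I_m * 'I_m) theta => p.1 != p.2 ->
    `|s theta0 p.1 - s theta p.1| < `|s theta0 p.1 - s theta0 p.2| / 2) _ filt).
  move=> [i j] /=; have [->|ij] := eqVneq i j; first by apply: nearW.
  have := scalar_continuous (s_lin i) (x:=theta0).
  move=> /cvgrPdist_lt/(_ _ (gap0 _ _ ij)).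
  by apply: (@filterS _ _ filt) => theta.
have := @filterI _ _ filt _ _ nearL near_gap.
rewrite nbhsE => -[U [Uopen U0] UP].
exists U; split=> // theta theta'; rewrite !inE.
move=> /UP[Ltheta close] /UP[Ltheta' close'] /coef_map_eq[eq_char eq_minor].
rewrite !char_poly_input_minor in eq_minor; try exact: A_acyclic.
apply: (recover _ _ Ltheta Ltheta' _ eq_char) => i.
have [j sij] := prod_XsubC_root eq_minor i.
rewrite -/(s theta i) -/(s theta' i).
have {}sij : s theta i = s theta' j := sij.
have [ji|ij] := eqVneq i j; first by move: sij; rewrite -ji.
(* Otherwise one number would be closer than half the gap to both ends. *)
have := ltrD (close (i, j) ij) (close' (j, i) (contra_neq esym ij)).
rewrite /= -sij [X in _ < _ + X / _]distrC -splitr ltNge.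
by rewrite [`|s theta0 j - _|]distrC ler_distD.
Qed.
End Identification.

(** * Determinants of bordered triangular matrices *)

Lemma sumr_mulrb_eq (V : nmodType) (I : finType) (F : I -> V) j :
  \sum_i F i *+ (i == j) = F j.
Proof. by under eq_bigr do rewrite mulrb; rewrite -big_mkcond big_pred1_eq. Qed.

(** Look at the leading coefficient of the largest term with a nonzero factor. *)
Lemma distinct_sizes_free (F : idomainType) (I : finType) (P : I -> {poly F})
    (z : I -> F) :
  (forall i, P i != 0) -> injective (fun i => size (P i)) ->
  \sum_i z i *: P i = 0 -> forall i, z i = 0.
Proof.
move=> P0 Pinj sumP i; apply/eqP; apply: contraT => zi.
pose j := [arg max_(j > i | z j != 0) size (P j)].
have [zj jmax] : z j != 0 /\ forall k, z k != 0 -> (size (P k) <= size (P j))%N.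
  by rewrite /j; case: arg_maxnP.
have : (\sum_k z k *: P k)`_(size (P j)).-1 = 0 by rewrite sumP coef0.
rewrite coef_sum (bigD1 j)//= big1 ?addr0 => [|k kj].
  rewrite coefZ -lead_coefE => /eqP.
  by rewrite mulf_eq0 (negPf zj) lead_coef_eq0 (negPf (P0 j)).
rewrite coefZ; have [->|zk] := eqVneq (z k) 0; first by rewrite mul0r.
rewrite nth_default ?mulr0// -ltnS prednK ?size_poly_gt0//.
rewrite ltn_neqAle jmax// andbT; apply: contra_neq kj => e; exact: Pinj.
Qed.

(** Cramer's rule for the right-hand side [d * e_1], read backwards: it yields
    the determinant from a solution whose first entry is the cofactor.  For the
    matrices below such a solution is given by a one-term recursion, which is
    simpler than a cofactor expansion. *)
Lemma det_of_col (S : idomainType) m (C : 'M[S]_m.+1) (x : 'I_m.+1 -> S) d :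
  (forall i, \sum_j C i j * x j = d *+ (i == ord0)) ->
  x ord0 = cofactor C ord0 ord0 -> x ord0 != 0 -> \det C = d.
Proof.
move=> Cx x0 x0_neq0; apply: (mulIf x0_neq0).
have Cx' : C *m \col_j x j = \col_i (d *+ (i == ord0)).
  by apply/colP => i; rewrite !mxE -Cx; apply: eq_bigr => j _; rewrite mxE.
transitivity ((\adj C *m C *m \col_j x j) ord0 ord0).
  by rewrite mul_adj_mx mul_scalar_mx !mxE.
rewrite -mulmxA Cx' mxE (bigD1 ord0)//= big1 ?addr0 => [|j /negPf j0].
  by rewrite !mxE eqxx mulr1n x0 mulrC.
by rewrite !mxE j0 mulr0.
Qed.

Lemma det_of_row (S : idomainType) m (C : 'M[S]_m.+1) (y : 'I_m.+1 -> S) d :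
  (forall j, \sum_i y i * C i j = d *+ (j == ord0)) ->
  y ord0 = cofactor C ord0 ord0 -> y ord0 != 0 -> \det C = d.
Proof.
move=> yC y0 y0_neq0; rewrite -det_tr; apply: (det_of_col (x := y)) => // [j|].
  by rewrite -yC; apply: eq_bigr => i _; rewrite mxE mulrC.
by rewrite cofactor_tr.
Qed.

Section BorderedDet.
Variables (R : realType) (m : nat).

Lemma size_prod_XaddC (I : Type) (r : seq I) (f : I -> R) :
  size (\prod_(i <- r) ('X + (f i)%:P)) = (size r).+1.
Proof.
by under eq_bigr do rewrite -[f _]opprK polyCN; rewrite size_prod_XsubC.
Qed.

Lemma prod_XaddC_neq0 (I : Type) (r : seq I) (f : I -> R) :
  \prod_(i <- r) ('X + (f i)%:P) != 0.
Proof. by rewrite -size_poly_gt0 size_prod_XaddC. Qed.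

Variable tail : 'I_m.+1 -> {poly R}.
Hypotheses (tail_neq0 : forall i, tail i != 0)
  (tail_size : injective (fun i => size (tail i))).

(** Both characteristic polynomials computed below have this form, where the
    polynomials [tail j] are determined by the diagonal.  As their degrees are
    distinct, the numbers [s] and [e j] can be read off. *)
Lemma bordered_det_inj (s s' : R) (e e' : 'I_m.+1 -> R) :
  e ord0 = 0 -> e' ord0 = 0 ->
  ('X + s%:P) * tail ord0 - \sum_j e j *: tail j =
  ('X + s'%:P) * tail ord0 - \sum_j e' j *: tail j ->
  s = s' /\ e =1 e'.
Proof.
move=> e0 e'0 eq_det.
pose z j := (s - s') *+ (j == ord0) - (e j - e' j).
have z0 : forall j, z j = 0.
  apply: (distinct_sizes_free tail_neq0 tail_size).
  under eq_bigr do rewrite /z !scalerBl -scalerMnl.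
  rewrite !sumrB (sumr_mulrb_eq (fun j => _ *: tail j)) scalerBl.
  move: eq_det; rewrite !mulrDl !mul_polyC -!addrA => /addrI /eqP.
  rewrite subr_eq => /eqP ->.
  apply/eqP; rewrite addrA subr_eq0; apply/eqP.
  by rewrite -!addrA [LHS]addrC !addrA subrK addrC.
split; first by have := z0 ord0; rewrite /z e0 e'0 !subr0 => /subr0_eq.
move=> j; have [->|/negPf j0] := eqVneq j ord0; first by rewrite e0 e'0.
by have := z0 j; rewrite /z j0 sub0r => /eqP; rewrite oppr_eq0 subr_eq0 => /eqP.
Qed.
End BorderedDet.

Section FinChar.
Variables (R : realType) (m : nat) (s a b : nat -> R).

(** Compartment j sends a_j to the next compartment and b_j to the first one; s_j
    is its total outflow. *)
Definition fin_matrix : 'M[R]_m.+1 := \matrix_(i, j)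
  (a j *+ (i == j.+1 :> nat) + b j *+ (i == ord0) - s j *+ (i == j)).

Definition fin_tail (j : nat) : {poly R} :=
  \prod_(j <= k < m) ('X + (s k.+1)%:P).

Lemma fin_char_poly_mx i j : char_poly_mx fin_matrix i j =
  ('X + (s j)%:P) *+ (i == j) - (a j)%:P *+ (i == j.+1 :> nat) - (b j)%:P *+ (i == ord0).
Proof.
rewrite !mxE polyCB polyCD !polyCMn !mulrnDl opprB opprD -!addrA.
by congr (_ + _).
Qed.

Hypothesis b0 : b 0 = 0.

Lemma fin_acyclic : acyclic_off_input fin_matrix.
Proof.
move=> i j i0 ij; rewrite !mxE -!val_eqE /= (ltn_eqF ij).
by rewrite (ltn_eqF (leqW ij)) (gtn_eqF i0) !mulr0n !addr0 subrr.
Qed.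

Lemma fin_minor : char_poly (input_minor fin_matrix) = fin_tail 0.
Proof.
rewrite char_poly_input_minor; last exact: fin_acyclic.
rewrite /fin_tail big_mkord; apply: eq_bigr => i _.
rewrite !mxE eqxx /= (ltn_eqF (ltnSn _)) !mulr0n addr0 add0r mulr1n.
by rewrite polyCN opprK.
Qed.

Lemma fin_char_poly : char_poly fin_matrix =
  ('X + (s 0)%:P) * fin_tail 0 -
  \sum_(j < m.+1) (b j * \prod_(0 <= k < j) a k) *: fin_tail j.
Proof.
pose x (j : nat) := (\prod_(0 <= k < j) a k)%:P * fin_tail j.
have x0 : x 0 = fin_tail 0 by rewrite /x big_geq// mul1r.
(* Row j + 1 is (X + s_{j+1}) x_{j+1} = a_j x_j. *)
apply: (det_of_col (x := x)).
- move=> i; under eq_bigr do rewrite fin_char_poly_mx !mulrBl 3!mulrnAl.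
  rewrite !sumrB; under eq_bigr do rewrite eq_sym.
  rewrite (sumr_mulrb_eq (fun j : 'I_m.+1 => _ * x j)).
  have [->|i0] := eqVneq i ord0.
    rewrite x0 mulr1n [X in _ - X - _]big1 => [|j _]; last by rewrite mulr0n.
    rewrite subr0; congr (_ - _); apply: eq_bigr => j _.
    by rewrite mulr1n /x mulrA -polyCM mul_polyC.
  rewrite mulr0n [X in _ - _ - X]big1 ?subr0 => [|j _]; last by rewrite mulr0n.
  have [p iS] : exists p, i = p.+1 :> nat by exists i.-1; rewrite prednK// lt0n.
  have pm : (p < m)%N by rewrite -ltnS -iS.
  under eq_bigr => j _.
    rewrite iS eqSS eq_sym (_ : (j == p :> nat) = (j == Ordinal (leqW pm))) //; over.
  rewrite (sumr_mulrb_eq (fun j : 'I_m.+1 => _ * x j)) /= iS.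
  rewrite /x big_nat_recr//= polyCM /fin_tail [in X in _ - X](big_ltn pm).
  by ring.
- by rewrite x0 cofactor_char_poly fin_minor.
- by rewrite x0; exact: prod_XaddC_neq0.
Qed.
End FinChar.

Section WingChar.
Variables (R : realType) (m : nat) (s a c : nat -> R).

(** Compartment j sends a_j to the cyclically next one, and the first one sends
    c_i to compartment i. *)
Definition wing_matrix : 'M[R]_m.+1 := \matrix_(i, j)
  (a j *+ (i == ordS j) + c i *+ (j == ord0) - s j *+ (i == j)).

Definition wing_tail (j : nat) : {poly R} :=
  \prod_(1 <= k < j) ('X + (s k)%:P).

Lemma wing_char_poly_mx i j : char_poly_mx wing_matrix i j =
  ('X + (s j)%:P) *+ (i == j) - (a j)%:P *+ (i == ordS j) - (c i)%:P *+ (j == ord0).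
Proof.
rewrite !mxE polyCB polyCD !polyCMn !mulrnDl opprB opprD -!addrA.
by congr (_ + _).
Qed.

Hypotheses (a0 : a 0 = 0) (c0 : c 0 = 0).

Lemma val_ordS (j : 'I_m.+1) : ordS j = (if (j < m)%N then j.+1 else 0) :> nat.
Proof.
rewrite /=; case: ltnP => jm; first by rewrite modn_small.
have -> : j = m :> nat by apply/anti_leq; rewrite jm -ltnS ltn_ord.
by rewrite modnn.
Qed.

Lemma eq_ordS (i j : 'I_m.+1) :
  (i == ordS j) = (i == (if (j < m)%N then j.+1 else 0) :> nat).
Proof. by rewrite -val_ordS. Qed.

Lemma wing_acyclic : acyclic_off_input wing_matrix.
Proof.
move=> i j i0 ij; rewrite !mxE eq_ordS -!val_eqE /= (ltn_eqF ij) (gtn_eqF (ltn_trans i0 ij)).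
case: ifP => _; first by rewrite (ltn_eqF (leqW ij)) !mulr0n addr0 subrr.
by rewrite (gtn_eqF i0) !mulr0n addr0 subrr.
Qed.

Lemma wing_minor : char_poly (input_minor wing_matrix) = wing_tail m.+1.
Proof.
rewrite char_poly_input_minor; last exact: wing_acyclic.
rewrite /wing_tail big_add1 /= big_mkord; apply: eq_bigr => i _.
rewrite !mxE eq_ordS -!val_eqE /= /bump add1n eqxx; case: ifP => _.
  by rewrite (ltn_eqF (ltnSn _)) !mulr0n addr0 add0r mulr1n polyCN opprK.
by rewrite !mulr0n addr0 add0r mulr1n polyCN opprK.
Qed.

Lemma wing_char_poly : char_poly wing_matrix =
  ('X + (s 0)%:P) * wing_tail m.+1 -
  \sum_(j < m.+1) (c j * \prod_(j <= k < m.+1) a k) *: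
     wing_tail (if j == ord0 then m.+1 else j).
Proof.
pose Y (j : nat) := (\prod_(j <= k < m.+1) a k)%:P * wing_tail j.
have Ym : Y m.+1 = wing_tail m.+1 by rewrite /Y big_geq// mul1r.
pose y (j : 'I_m.+1) := if j == ord0 then wing_tail m.+1 else Y j.
have yS j : y (ordS j) = Y j.+1.
  rewrite /y eq_sym eq_ordS val_ordS; case: ltnP => //= jm.
  by have -> : j = m :> nat by apply/anti_leq; rewrite jm -ltnS ltn_ord.
(* Column j is (X + s_j) y_j = a_j y_{j+1}, where y_{m+1} means y_0. *)
apply: (det_of_row (y := y)).
- move=> j; under eq_bigr do rewrite wing_char_poly_mx !mulrBr 3!mulrnAr.
  rewrite !sumrB (sumr_mulrb_eq (fun i => y i * _)) (sumr_mulrb_eq (fun i => y i * _)) yS.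
  have [->|j0] := eqVneq j ord0.
    rewrite a0 polyC0 mulr0 subr0 {1}/y eqxx mulrC mulr1n; congr (_ - _).
    apply: eq_bigr => i _; rewrite mulr1n /y; case: eqP => [->|_].
      by rewrite c0 polyC0 mulr0 mul0r scale0r.
    by rewrite /Y mulrC mulrA -polyCM mul_polyC.
  rewrite mulr0n [X in _ - _ - X]big1 ?subr0 => [|i _]; last by rewrite mulr0n.
  rewrite /y (negPf j0) /Y (big_ltn (ltn_ord j)) polyCM.
  have -> : wing_tail j.+1 = wing_tail j * ('X + (s j)%:P).
    by rewrite /wing_tail big_nat_recr ?lt0n.
  by ring.
- by rewrite cofactor_char_poly wing_minor.
- exact: prod_XaddC_neq0.
Qed.
End WingChar.

(** * Recovery of the rates *)

(** With p_i = a_0 ... a_{i-1}, the data are s_i = a_i + b_i + r_i and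
    q_i = b_i p_i, and every compartment i <> l satisfies the balance
    s_i p_i = p_{i+1} + q_i.  Started from p_0 = 1 it determines p_0, ..., p_l;
    run backwards from p_{m+1} = 0 it determines p_{l+1}, ..., p_{m+1}.  The p_i
    give a_i and b_i, and then s_i gives r_i. *)
Lemma fin_recover (F : fieldType) (m l : nat) (a b r a' b' r' : nat -> F) :
  b 0 = 0 -> b' 0 = 0 -> a m = 0 -> a' m = 0 ->
  (forall i, (i < m)%N -> a i != 0) ->
  (forall i, (0 < i <= m)%N -> a i + b i + r i != 0) ->
  (forall i, (i <= m)%N -> i != l -> r i = 0) ->
  (forall i, (i <= m)%N -> i != l -> r' i = 0) ->
  (forall i, (i <= m)%N -> a i + b i + r i = a' i + b' i + r' i) ->
  (forall i, (i <= m)%N ->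
     b i * \prod_(0 <= k < i) a k = b' i * \prod_(0 <= k < i) a' k) ->
  forall i, (i <= m)%N -> [/\ a i = a' i, b i = b' i & r i = r' i].
Proof.
move=> b0 b'0 am a'm a_neq0 s_neq0 rl r'l eq_s eq_q.
pose p i := \prod_(0 <= k < i) a k; pose p' i := \prod_(0 <= k < i) a' k.
have pS i : p i.+1 = p i * a i by rewrite /p big_nat_recr.
have p'S i : p' i.+1 = p' i * a' i by rewrite /p' big_nat_recr.
have p_neq0 i : (i <= m)%N -> p i != 0.
  elim: i => [_|i IH im]; first by rewrite /p big_geq ?oner_neq0.
  by rewrite pS mulf_neq0 ?IH ?a_neq0// ltnW.
have balance i : (i <= m)%N -> i != l ->
    p i * (a i + b i + r i) = p i.+1 + b i * p i.
  by move=> im il; rewrite pS rl// addr0 mulrDr [b i * _]mulrC.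
have balance' i : (i <= m)%N -> i != l ->
    p' i * (a i + b i + r i) = p' i.+1 + b i * p i.
  by move=> im il; rewrite eq_s// eq_q// p'S r'l// addr0 mulrDr [b' i * _]mulrC.
have low i : (i <= l)%N -> (i <= m)%N -> p i = p' i.
  elim: i => [_ _|i IH il im]; first by rewrite /p /p' !big_geq.
  have i_neq_l : i != l by rewrite ltn_eqF.
  apply: (addIr (b i * p i)); rewrite -balance ?(ltnW im)// -balance' ?(ltnW im)//.
  by rewrite IH // ltnW.
have high j : forall i, (i + j = m.+1)%N -> (l < i)%N -> p i = p' i.
  elim: j => [|j IH] i; first by rewrite addn0 => -> _; rewrite pS p'S am a'm !mulr0.
  rewrite addnS => -[ij] li; have im : (i <= m)%N by rewrite -ij leq_addr.
  have i_gt0 : (0 < i)%N by apply: leq_trans li.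
  have si : a i + b i + r i != 0 by rewrite s_neq0 ?i_gt0.
  apply: (mulIf si); rewrite balance ?balance' ?gtn_eqF//.
  by rewrite IH ?(leqW li)// addSn ij.
have eq_p i : (i <= m.+1)%N -> p i = p' i.
  move=> im; have [il|li] := leqP i l.
    have [im'|mi] := leqP i m; first exact: low.
    by rewrite (_ : i = m.+1) ?pS ?p'S ?am ?a'm ?mulr0//; apply/anti_leq; rewrite im.
  by apply: (high (m.+1 - i)%N) => //; rewrite subnKC.
move=> i im; have eq_a : a i = a' i.
  by apply: (mulfI (p_neq0 _ im)); rewrite -pS [p i]eq_p ?(leqW im)// -p'S eq_p.
have eq_b : b i = b' i.
  by apply: (mulIf (p_neq0 _ im)); rewrite eq_q// -/(p' i) -eq_p// (leqW im).
by split=> //; have := eq_s i im; rewrite eq_a eq_b => /addrI.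
Qed.

(** All the a_i with i <> l are known from the sums a_i + r_i, hence also the c_j
    with j > l, from c_j a_j ... a_m.  If l > 0, the products a_l c_j with j <= l
    are known as well, and so is c_1 + ... + c_l, because compartment 0 has no
    leak; the quotient of the sums is a_l.  The rest follows. *)
Lemma wing_recover (F : fieldType) (m l : nat) (a c r a' c' r' : nat -> F) :
  (forall i, (0 < i <= m)%N -> a i != 0) ->
  (forall i, (0 < i <= m)%N -> a' i != 0) ->
  (forall i, (0 < i <= m)%N -> \sum_(1 <= j < i.+1) c j != 0) ->
  (forall i, (i <= m)%N -> i != l -> r i = 0) ->
  (forall i, (i <= m)%N -> i != l -> r' i = 0) ->
  (forall i, (0 < i <= m)%N -> a i + r i = a' i + r' i) ->
  \sum_(1 <= j < m.+1) c j + r 0 = \sum_(1 <= j < m.+1) c' j + r' 0 ->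
  (forall i, (0 < i <= m)%N ->
     c i * \prod_(i <= k < m.+1) a k = c' i * \prod_(i <= k < m.+1) a' k) ->
  (forall i, (0 < i <= m)%N -> a i = a' i /\ c i = c' i) /\
  (forall i, (i <= m)%N -> r i = r' i).
Proof.
move=> a_neq0 a'_neq0 C_neq0 rl r'l eq_s eq_s0 eq_q.
have eq_a_off i : (0 < i <= m)%N -> i != l -> a i = a' i.
  move=> im il; have := eq_s i im; have /andP[_ im'] := im.
  by rewrite rl// r'l// !addr0.
have prod_a_neq0 i j : (0 < i)%N -> (j <= m.+1)%N -> \prod_(i <= k < j) a k != 0.
  move=> i0 jm; rewrite big_nat prodf_seq_neq0; apply/allP => k _; apply/implyP.
  by move=> /andP[ik kj]; rewrite a_neq0// (leq_trans i0 ik) -ltnS (leq_trans kj).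
have eq_prod i j : (0 < i)%N -> (j <= m.+1)%N -> (forall k, (i <= k < j)%N -> a k = a' k) ->
    \prod_(i <= k < j) a' k = \prod_(i <= k < j) a k.
  by move=> i0 jm eq_a; apply: eq_big_nat => k ik; rewrite eq_a.
have eq_c_above i : (0 < i <= m)%N -> (forall k, (i <= k <= m)%N -> a k = a' k) ->
    c i = c' i.
  move=> im eq_a; have /andP[i0 _] := im.
  apply: (mulIf (prod_a_neq0 i m.+1 i0 (leqnn _))).
  by rewrite eq_q// eq_prod// => k; rewrite ltnS; exact: eq_a.
suff eq_a i : (0 < i <= m)%N -> a i = a' i.
  have eq_c i : (0 < i <= m)%N -> c i = c' i.
    move=> im; apply: eq_c_above => // k /andP[ik km]; apply: eq_a.
    by rewrite km andbT; case/andP: im => i0 _; exact: leq_trans ik.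
  split=> [i im|i im]; first by rewrite eq_a ?eq_c.
  case: i im => [_|i im]; last by apply: (addrI (a i.+1)); rewrite eq_s// eq_a.
  move: eq_s0; rewrite (eq_big_nat _ _ (F2 := c')) => [/addrI//|i im].
  by rewrite eq_c.
move=> im; have [il|] := eqVneq i l; last exact: eq_a_off.
rewrite -{}il in rl r'l eq_a_off.
have /andP[i0 im'] := im.
have eq_ac j : (0 < j <= i)%N -> a i * c j = a' i * c' j.
  move=> /andP[j0 ji].
  have jm : (0 < j <= m)%N by rewrite j0 (leq_trans ji).
  have := eq_q j jm; rewrite !(@big_cat_nat _ _ _ i j m.+1) ?(leqW im')//=.
  rewrite !(@big_ltn _ _ _ i m.+1)//.
  rewrite [in RHS](eq_prod j i)// ?(leqW im')// => [|k /andP[jk ki]]; last first.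
    by apply: eq_a_off; rewrite ?(ltn_eqF ki)// (leq_trans j0 jk) (leq_trans (ltnW ki)).
  rewrite [in RHS](eq_prod i.+1 m.+1)// => [|k /andP[ik km]]; last first.
    by apply: eq_a_off; rewrite ?(gtn_eqF ik)// (leq_ltn_trans _ ik).
  have := prod_a_neq0 j i j0 (leqW im').
  have := prod_a_neq0 i.+1 m.+1 isT (leqnn _).
  set P := \prod_(j <= k < i) a k; set Q := \prod_(i.+1 <= k < m.+1) a k.
  move=> Q_neq0 P_neq0 E; apply: (mulIf P_neq0); apply: (mulIf Q_neq0).
  by transitivity (c j * (P * (a i * Q))); [ring | rewrite E; ring].
have eq_C : \sum_(1 <= j < i.+1) c j = \sum_(1 <= j < i.+1) c' j.
  move: eq_s0; rewrite rl ?r'l ?(ltn_eqF i0)// !addr0.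
  rewrite !(@big_cat_nat _ _ _ i.+1 1 m.+1)//=.
  rewrite [X in _ + X = _ -> _](eq_big_nat _ _ (F2 := c')) => [/addIr//|j /andP[ij jm]].
  apply: eq_c_above => [|k /andP[jk km]]; first by rewrite (leq_trans _ ij).
  apply: eq_a_off; first by rewrite km (leq_trans i0)// (leq_trans _ jk)// ltnW.
  by rewrite gtn_eqF// (leq_trans ij).
apply: (mulIf (C_neq0 i im)); rewrite {2}eq_C !mulr_sumr.
by apply: eq_big_nat => j; rewrite ltnS; exact: eq_ac.
Qed.

(** * The Fin and Wing models *)

Section Graphs.
Variable m : nat.
Hypothesis m_gt0 : (0 < m)%N.
Implicit Types i j : 'I_m.+1.

Lemma ordS_neq i : (i == ordS i) = false.
Proof.
rewrite eq_ordS; case: ltnP => [_|mi]; first by rewrite ltn_eqF.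
by rewrite gtn_eqF// (leq_trans m_gt0).
Qed.

Lemma cycle_graphE i j : cycle_graph i j = (j == ordS i).
Proof.
rewrite /cycle_graph /label !eqSS eq_ordS; case: ltnP => [im|mi].
  by rewrite (ltn_eqF im) orbF.
have -> : i = m :> nat by apply/anti_leq; rewrite mi -ltnS ltn_ord.
by rewrite eqxx (ltn_eqF (ltn_ord j)).
Qed.

Lemma fin_graphE i j :
  fin_graph i j = (j == ordS i) || ((0 < i)%N && (j == ord0)).
Proof.
rewrite /fin_graph cycle_graphE /label /= eqSS ltnS -andbA.
rewrite -[j == ord0]/(j == 0 :> nat) eq_ordS; case: ltnP => //= mi.
by case: eqVneq; rewrite /= ?andbF.
Qed.

Lemma wing_graphE i j :
  wing_graph i j = (j == ordS i) || ((i == ord0) && (0 < j)%N).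
Proof.
rewrite /wing_graph cycle_graphE /label eqSS (ltn_ord j) andbT ltnS.
rewrite -[i == ord0]/(i == 0 :> nat) eq_ordS.
case: (nat_of_ord i) => [|i']; last by rewrite !andFb.
by rewrite m_gt0; case: (nat_of_ord j) => [|[|]].
Qed.

Lemma cycle_connected (e : rel 'I_m.+1) :
  subrel (@cycle_graph m.+1) e -> forall i j, connect e i j.
Proof.
move=> cycle_e.
have step i : connect e i (ordS i) by rewrite connect1// cycle_e// cycle_graphE.
have from0 k (km : (k < m.+1)%N) : connect e ord0 (Ordinal km).
  elim: k km => [|k IH] km; first by rewrite (_ : Ordinal km = ord0)//; exact/val_inj.
  apply: connect_trans (IH (ltnW km)) _.
  rewrite (_ : Ordinal km = ordS (Ordinal (ltnW km)))//; apply/eqP.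
  by rewrite eq_ordS /= ifT.
have to0 k i : (i + k)%N = m -> connect e i ord0.
  elim: k i => [|k IH] i ik.
    rewrite (_ : ord0 = ordS i)//; apply/eqP.
    by move: ik; rewrite addn0 eq_ordS => ->; rewrite ltnn.
  apply: connect_trans (step i) _; apply: IH.
  have im : (i < m)%N by apply: leq_trans (eq_leq ik); rewrite addnS ltnS leq_addr.
  by rewrite val_ordS im addSnnS.
move=> i j; apply: (@connect_trans _ _ ord0); last by case: j => j; exact: from0.
by apply: (to0 (m - i)%N); rewrite subnKC// -ltnS.
Qed.

Lemma leak_position (Leak : {set 'I_m.+1}) : (#|Leak| <= 1)%N ->
  exists l : nat, forall i : nat, (i <= m)%N -> i != l -> inord i \notin Leak.
Proof.
move=> /card_le1P le1; case: (set_0Vmem Leak) => [->|[x xL]].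
  by exists 0 => i _ _; rewrite inE.
exists x => i im; apply: contraNN; rewrite (le1 _ xL) inE => /eqP.
by move=> /(congr1 val); rewrite /= inordK// => ->.
Qed.
End Graphs.

Section Loopless.
Variables (R : realType) (n : nat) (M : model n).
Hypothesis loopless : forall i, ~~ edge M i i.
Implicit Types theta : 'rV[R]_#|param M|.

Lemma compartmental_matrixE theta i j : compartmental_matrix theta i j =
  edge_rate theta i j -
    (\sum_p edge_rate theta p j + leak_rate theta j) *+ (i == j).
Proof.
rewrite mxE; case: eqP => [<-|_]; last by rewrite mulr0n subr0.
rewrite mulr1n (edge_rate0 _ (loopless i)) sub0r opprD addrC.
congr (- _ - _); rewrite [RHS](bigID (edge M i))/= [X in _ + X]big1 ?addr0// => p.
exact: edge_rate0.
Qed.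
End Loopless.

Section Fin.
Variables (R : realType) (m : nat) (L : {set 'I_m.+1}).
Hypotheses (m_gt1 : (1 < m)%N) (L_le1 : (#|L| <= 1)%N).
Let m_gt0 : (0 < m)%N := ltnW m_gt1.

Definition fin_model := Model (@fin_graph m.+1) [set ord0] [set ord0] L.
Local Notation theta_t := 'rV[R]_#|param fin_model|.
Implicit Types theta : theta_t.

(** The rates as sequences, so that the recursions on compartments are recursions
    on natural numbers. *)
Definition fin_forth theta (j : nat) : R :=
  if (j < m)%N then edge_rate theta (ordS (inord j)) (inord j) else 0.
Definition fin_back theta (j : nat) : R :=
  if (0 < j)%N then edge_rate theta ord0 (inord j) else 0.
Definition fin_leak theta (j : nat) : R := leak_rate theta (inord j).
Definition fin_out theta (j : nat) : R :=
  fin_forth theta j + fin_back theta j + fin_leak theta j.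

Lemma fin_edge_rate theta i j : edge_rate theta i j =
  fin_forth theta j *+ (i == ordS j) + fin_back theta j *+ (i == ord0).
Proof.
rewrite /fin_forth /fin_back !inord_val; have [->|ij] := eqVneq i (ordS j).
  rewrite -[_ == ord0]/(ordS j == 0 :> nat) val_ordS; case: ltnP => [_|mj] /=.
    by rewrite addr0.
  have -> : ordS j = ord0 by apply/eqP; rewrite eq_sym eq_ordS ltnNge mj.
  by rewrite mul0rn add0r (leq_trans m_gt0).
rewrite mulr0n add0r; case: (eqVneq i ord0) ij => [->|i0] ij; last first.
  by rewrite edge_rate0//= fin_graphE// negb_or ij (negPf i0) andbF.
rewrite mulr1n; case: posnP => // j0; apply: edge_rate0.
by rewrite /= fin_graphE// negb_or ij j0.
Qed.

Lemma fin_loopless i : ~~ edge fin_model i i.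
Proof.
rewrite /= fin_graphE// ordS_neq//=.
by rewrite -[i == ord0]/(i == 0 :> nat); case: (nat_of_ord i).
Qed.

Lemma fin_matrixE theta : compartmental_matrix theta =
  fin_matrix m (fin_out theta) (fin_forth theta) (fin_back theta).
Proof.
apply/matrixP => i j; rewrite (compartmental_matrixE fin_loopless) mxE.
rewrite (eq_bigr _ (fun p _ => fin_edge_rate theta p j)) big_split /=.
rewrite (sumr_mulrb_eq (fun=> fin_forth theta j)) (sumr_mulrb_eq (fun=> fin_back theta j)).
rewrite /fin_out /fin_leak inord_val; congr (_ - _).
rewrite fin_edge_rate eq_ordS /fin_forth; case: ifP => // _.
by rewrite !mul0rn.
Qed.

Lemma fin_diag theta (i : 'I_m) :
  compartmental_matrix theta (lift ord0 i) (lift ord0 i) = - fin_out theta i.+1.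
Proof.
by rewrite fin_matrixE !mxE eqxx /= (ltn_eqF (ltnSn _)) !mulr0n addr0 add0r.
Qed.

Lemma fin_ends theta : fin_forth theta m = 0 /\ fin_back theta 0 = 0.
Proof. by rewrite /fin_forth ltnn /fin_back. Qed.

(** The rates 1 forward and 2j backward make the outflows of the compartments
    j > 0 distinct: they are 2j + 1 for j < m and 2m for j = m. *)
Lemma fin_identifiable : generically_locally_identifiable R fin_model.
Proof.
have [w [[w_forth w_back] w_leak]] : exists w : theta_t,
    (forall j, (j < m)%N -> fin_forth w j = 1) *
    (forall j, (0 < j <= m)%N -> fin_back w j = j.*2%:R) /\
    forall j, fin_leak w j = 0.
  have [w [w_edge w_leak]] := @exists_rates R _ fin_model
    (fun i j => if i == ord0 then j.*2%:R else 1) (fun=> 0).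
  exists w; split; last by move=> j; rewrite /fin_leak w_leak if_same.
  split=> [j jm|j /andP[j0 jm]].
    have jE : nat_of_ord (inord j : 'I_m.+1) = j by rewrite inordK// ltnW.
    rewrite /fin_forth jm w_edge /= fin_graphE// eqxx /=.
    by rewrite -[ordS _ == ord0]/(ordS _ == 0 :> nat) val_ordS jE jm.
  rewrite /fin_back j0 w_edge /= fin_graphE// inordK// eqxx j0 orbT.
  by [].
have w_out j : (j < m)%N -> fin_out w j.+1 = (j.+1.*2 + (j.+1 < m))%:R.
  move=> jm; rewrite /fin_out w_leak addr0 w_back ?jm// addrC natrD; congr (_ + _).
  by case: ltnP => jm'; [rewrite w_forth | rewrite /fin_forth ltnNge jm'].
have [l lP] := leak_position L_le1.
have leak0 theta i : (i <= m)%N -> i != l -> fin_leak theta i = 0.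
  by move=> im il; rewrite /fin_leak leak_rate0//= lP.
apply: (@identifiable_of_recovery R m fin_model erefl erefl _ _
  ('I_m + 'I_m)%type
  (fun d theta => match d with
     | inl j => fin_forth theta j
     | inr j => compartmental_matrix theta (lift ord0 j) (lift ord0 j) end) w).
- by move=> theta; rewrite fin_matrixE; apply: fin_acyclic.
- by apply: cycle_connected => i j ij; rewrite /= /fin_graph ij.
- move=> [j|j]; last exact: scalar_compartmental_matrix.
  by rewrite /fin_forth ltn_ord; apply: scalar_edge_rate.
- move=> [j|j]; first by rewrite w_forth ?oner_neq0.
  by rewrite fin_diag w_out// oppr_eq0 pnatr_eq0 doubleS.
- move=> i j; rewrite !fin_diag !w_out// eqr_opp eqr_nat.
  apply: contraNN => /eqP /(congr1 half); rewrite ![(_.*2 + _)%N]addnC.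
  by rewrite !half_bit_double => -[] /val_inj ->.
move=> theta theta' good good' eq_diag; rewrite !fin_matrixE.
have [am b0] := fin_ends theta; have [a'm b'0] := fin_ends theta'.
have eq_out i : (i < m)%N -> fin_out theta i.+1 = fin_out theta' i.+1.
  by move=> im; have := eq_diag (Ordinal im); rewrite !fin_diag => /oppr_inj.
have eq_tail j : fin_tail m (fin_out theta') j = fin_tail m (fin_out theta) j.
  by apply: eq_big_nat => k /andP[_ km]; rewrite eq_out.
rewrite !fin_char_poly//; under [in RHS]eq_bigr do rewrite eq_tail.
rewrite eq_tail => /bordered_det_inj[| | | |eq_out0 eq_q].
- by move=> j; exact: prod_XaddC_neq0.
- move=> i j; rewrite /fin_tail !size_prod_XaddC !size_iota => -[eq_sub].
  by apply/val_inj; rewrite /= -(subKn (ltn_ord i : (i <= m)%N)) eq_sub subKn// -ltnS.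
- by rewrite b0 mul0r.
- by rewrite b'0 mul0r.
have rec := @fin_recover R m l _ _ _ _ _ _ b0 b'0 am a'm _ _ (leak0 theta) (leak0 theta').
have {}rec i : (i <= m)%N -> [/\ fin_forth theta i = fin_forth theta' i,
    fin_back theta i = fin_back theta' i & fin_leak theta i = fin_leak theta' i].
  move=> im; apply: rec => // [j jm|j /andP[j0 jm]|[//|j] jm|j jm].
  - exact: good (inl (Ordinal jm)).
  - case: j j0 jm => // j _ jm.
    by have := good (inr (Ordinal jm)); rewrite fin_diag oppr_eq0.
  - exact: eq_out.
  - exact: eq_q (Ordinal (jm : (j < m.+1)%N)).
apply: rates_inj => [i j|j].
  by rewrite !fin_edge_rate; have [-> -> _] := rec j (ltn_ord j).
by have [_ _] := rec j (ltn_ord j); rewrite /fin_leak inord_val.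
Qed.
End Fin.

Section Wing.
Variables (R : realType) (m : nat) (L : {set 'I_m.+1}).
Hypotheses (m_gt0 : (0 < m)%N) (L_le1 : (#|L| <= 1)%N).

Definition wing_model := Model (@wing_graph m.+1) [set ord0] [set ord0] L.
Local Notation theta_t := 'rV[R]_#|param wing_model|.
Implicit Types theta : theta_t.

Definition wing_forth theta (j : nat) : R :=
  if (0 < j)%N then edge_rate theta (ordS (inord j)) (inord j) else 0.
Definition wing_split theta (i : nat) : R :=
  if (0 < i)%N then edge_rate theta (inord i) ord0 else 0.
Definition wing_leak theta (j : nat) : R := leak_rate theta (inord j).
Definition wing_out theta (j : nat) : R :=
  (wing_forth theta j +
   (\sum_(1 <= i < m.+1) wing_split theta i) *+ (j == 0)%N) + wing_leak theta j.

Lemma wing_edge_rate theta i j : edge_rate theta i j =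
  wing_forth theta j *+ (i == ordS j) + wing_split theta i *+ (j == ord0).
Proof.
rewrite /wing_forth /wing_split !inord_val.
have [->|j0] := eqVneq j ord0.
  rewrite /= mul0rn add0r mulr1n; case: posnP => // i0; apply: edge_rate0.
  by rewrite /= wing_graphE// eq_ordS i0 m_gt0.
rewrite mulr0n addr0 lt0n -[(j : nat) != 0]/(j != ord0) j0.
have [->//|ij] := eqVneq i (ordS j); rewrite mulr0n; apply: edge_rate0.
by rewrite /= wing_graphE// negb_or ij (negPf j0).
Qed.

Lemma wing_loopless i : ~~ edge wing_model i i.
Proof.
rewrite /= wing_graphE// ordS_neq//=.
by rewrite -[i == ord0]/(i == 0 :> nat); case: (nat_of_ord i).
Qed.

Lemma wing_matrixE theta : compartmental_matrix theta =
  wing_matrix m (wing_out theta) (wing_forth theta) (wing_split theta).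
Proof.
apply/matrixP => i j; rewrite (compartmental_matrixE wing_loopless) mxE.
rewrite (eq_bigr _ (fun p _ => wing_edge_rate theta p j)) big_split /=.
rewrite (sumr_mulrb_eq (fun=> wing_forth theta j)) sumrMnl.
rewrite -(big_mkord xpredT (wing_split theta)) (big_ltn (ltn0Sn m)) [wing_split _ 0]/=.
by rewrite add0r /wing_out /wing_leak inord_val wing_edge_rate.
Qed.

Lemma wing_diag theta (i : 'I_m) :
  compartmental_matrix theta (lift ord0 i) (lift ord0 i) =
  - (wing_forth theta i.+1 + wing_leak theta i.+1).
Proof.
rewrite wing_matrixE !mxE eqxx ordS_neq// !mulr0n addr0 add0r mulr1n.
by rewrite /wing_out mulr0n addr0.
Qed.

Lemma wing_starts theta : wing_forth theta 0 = 0 /\ wing_split theta 0 = 0.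
Proof. by []. Qed.

(** The rates j forward and 1 out of compartment 0 make the outflows of the
    compartments j > 0 distinct. *)
Lemma wing_identifiable : generically_locally_identifiable R wing_model.
Proof.
have [w [[w_forth w_split] w_leak]] : exists w : theta_t,
    (forall j, (0 < j <= m)%N -> wing_forth w j = j%:R) *
    (forall j, (0 < j <= m)%N -> wing_split w j = 1) /\
    forall j, wing_leak w j = 0.
  have [w [w_edge w_leak]] := @exists_rates R _ wing_model
    (fun i j => if j == ord0 then 1 else j%:R) (fun=> 0).
  exists w; split; last by move=> j; rewrite /wing_leak w_leak if_same.
  split=> [j /andP[j0 jm]|j /andP[j0 jm]].
    have jE : nat_of_ord (inord j : 'I_m.+1) = j by rewrite inordK.
    rewrite /wing_forth j0 w_edge /= wing_graphE// eqxx /=.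
    by rewrite -[inord _ == ord0]/(inord _ == 0 :> nat) jE (gtn_eqF j0).
  by rewrite /wing_split j0 w_edge /= wing_graphE// inordK// eqxx j0 orbT.
have [l lP] := leak_position L_le1.
have leak0 theta i : (i <= m)%N -> i != l -> wing_leak theta i = 0.
  by move=> im il; rewrite /wing_leak leak_rate0//= lP.
apply: (@identifiable_of_recovery R m wing_model erefl erefl _ _
  ('I_m + 'I_m)%type
  (fun d theta => match d with
     | inl j => wing_forth theta j.+1
     | inr j => \sum_(1 <= i < j.+2) wing_split theta i end) w).
- by move=> theta; rewrite wing_matrixE; apply: wing_acyclic.
- by apply: cycle_connected => i j ij; rewrite /= /wing_graph ij.
- move=> [j|j]; first exact: scalar_edge_rate.
  have -> : (fun theta => \sum_(1 <= i < j.+2) wing_split theta i) =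
      fun theta => \sum_(i < j.+1) edge_rate theta (inord i.+1) ord0.
    by apply/funext => theta; rewrite big_add1 big_mkord.
  by apply: scalar_sum => i _; exact: scalar_edge_rate.
- move=> [j|j]; first by rewrite w_forth ?pnatr_eq0 ?ltn_ord.
  rewrite (eq_big_nat _ _ (F2 := fun=> 1)) => [|i /andP[i0 ij]].
    by rewrite sumr_const_nat subn1 pnatr_eq0.
  by rewrite w_split// i0; exact: leq_trans (ij : (i <= j.+1)%N) (ltn_ord j).
- move=> i j; rewrite !wing_diag !w_leak !addr0 !w_forth ?ltn_ord//.
  by rewrite eqr_opp eqr_nat eqSS.
move=> theta theta' good good' eq_diag; rewrite !wing_matrixE.
have [a0 c0] := wing_starts theta; have [a'0 c'0] := wing_starts theta'.
have eq_s i : (0 < i <= m)%N -> wing_forth theta i + wing_leak theta i =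
    wing_forth theta' i + wing_leak theta' i.
  case: i => // i im; have := eq_diag (Ordinal im).
  by rewrite !wing_diag => /oppr_inj.
have eq_tail j : (j <= m.+1)%N ->
    wing_tail (wing_out theta') j = wing_tail (wing_out theta) j.
  move=> jm; apply: eq_big_nat => -[|k] // /andP[_ kj].
  by rewrite /wing_out !mulr0n !addr0 eq_s//=; exact: leq_trans kj jm.
rewrite !wing_char_poly//.
under [in RHS]eq_bigr => j _.
  rewrite eq_tail; last by case: ifP => // _; rewrite ltnW.
  over.
rewrite eq_tail// => eq_char.
have [||||eq_out0 eq_q] := @bordered_det_inj _ _
  (fun j : 'I_m.+1 => wing_tail (wing_out theta) (if j == ord0 then m.+1 else j))
  _ _ _ _ _ _ _ _ eq_char.
- by move=> j; exact: prod_XaddC_neq0.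
- move=> i j; rewrite /wing_tail !size_prod_XaddC !size_iota !subn1 => -[].
  have pos k : k != ord0 -> k.-1.+1 = k by move=> k0; rewrite prednK// lt0n.
  case: (eqVneq i ord0) => [->|/pos i0]; case: (eqVneq j ord0) => [->|/pos j0] //=.
  - by move=> mj; have := ltn_ord j; rewrite -j0 -mj ltnn.
  - by move=> im; have := ltn_ord i; rewrite -i0 im ltnn.
  - by move=> ij; apply/val_inj; rewrite /= -i0 ij.
- by rewrite c0 mul0r.
- by rewrite c'0 mul0r.
have [||||||eq_ac eq_r] := @wing_recover R m l (wing_forth theta)
  (wing_split theta) (wing_leak theta) (wing_forth theta') (wing_split theta')
  (wing_leak theta') _ _ _ (leak0 theta) (leak0 theta').
- by case=> // i im; exact: good (inl (Ordinal im)).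
- by case=> // i im; exact: good' (inl (Ordinal im)).
- by case=> // i im; exact: good (inr (Ordinal im)).
- exact: eq_s.
- by move: eq_out0; rewrite /wing_out a0 a'0 !add0r !mulr1n.
- by move=> i /andP[_ im]; exact: eq_q (Ordinal (im : (i < m.+1)%N)).
have eq_ac0 i : (i <= m)%N ->
    wing_forth theta i = wing_forth theta' i /\ wing_split theta i = wing_split theta' i.
  by case: i => [|i] im; [rewrite a0 a'0 c0 c'0 | exact: eq_ac].
apply: rates_inj => [i j|j].
  rewrite !wing_edge_rate; have [-> _] := eq_ac0 j (ltn_ord j).
  by have [_ ->] := eq_ac0 i (ltn_ord i).
by have := eq_r j (ltn_ord j); rewrite /wing_leak inord_val.
Qed.
End Wing.

Theorem theorem3p14 (R : realType) (n : nat) (n_ge3 : (3 <= n)%N)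
    (In Out Leak : {set 'I_n})
    (In1 : In = [set i : 'I_n | label i == 1%N]%SET)
    (Out1 : Out = [set i : 'I_n | label i == 1%N]%SET)
    (Leak_le1 : (#|Leak| <= 1)%N)
    (M : model n)
    (M_fin_or_wing : M = Model (@fin_graph n) In Out Leak \/
                     M = Model (@wing_graph n) In Out Leak) :
  generically_locally_identifiable R M.
Proof.
case: n n_ge3 In Out Leak In1 Out1 Leak_le1 M M_fin_or_wing => // m m_gt1.
move=> In Out Leak In1 Out1 Leak_le1 M.
have label1 : [set i : 'I_m.+1 | label i == 1%N]%SET = [set ord0]%SET.
  by apply/setP => i; rewrite !inE.
rewrite In1 Out1 label1 => -[] ->.
  exact: fin_identifiable.
by apply: wing_identifiable => //; exact: ltnW.
Qed.
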